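(* Let $(\mathcal X,d_{\mathcal X})$, $(\mathcal U,d_{\mathcal U})$ be metric spaces. Let $\mathcal S\colon\mathcal X\to\mathcal U$ be locally Hölder continuous with exponent $\beta\in(0,1]$ in the following sense: there exist $x_0\in\mathcal X$ and a nondecreasing function $C_{\mathcal S}\colon[0,\infty)\to[0,\infty)$ such that for every $r>0$ $$d_{\mathcal U}(\mathcal S(x_1),\mathcal S(x_2))\le C_{\mathcal S}(r)\,d_{\mathcal X}(x_1,x_2)^\beta\qquad\text{for all }x_1,x_2\in B_r(x_0),$$ where $B_r(x_0)=\{x\in\mathcal X\colon d_{\mathcal X}(x,x_0)\le r\}$. Let $p\in[1,\infty)$ and let $P,Q\in\mathcal P_{2\beta p}(\mathcal X)$ satisfy $$\int_{\mathcal X}C_{\mathcal S}(d_{\mathcal X}(x,x_0))^{2p}\,P(dx)\le C\quad\text{and}\quad\int_{\mathcal X}C_{\mathcal S}(d_{\mathcal X}(x,x_0))^{2p}\,Q(dx)\le C$$ for a constant $C<\infty$. Then the pushforward measures satisfy $\mathcal S_*P,\mathcal S_*Q\in\mathcal P_p(\mathcal U)$ and $$d_p(\mathcal S_*P,\mathcal S_*Q)\le 2\,C^{1/(2p)}\,d_{2\beta p}(P,Q)^\beta.$$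
   Context: Metric spaces carry their Borel $\sigma$-algebras; $\mathcal P(\mathcal X)$ is the set of Borel probability measures on $\mathcal X$. For $q>0$, $\mathcal P_q(\mathcal X)=\{P\in\mathcal P(\mathcal X)\colon\int d_{\mathcal X}(x,x_0)^q\,P(dx)<\infty\text{ for some }x_0\in\mathcal X\}$ and $$d_q(P,Q)=\inf_{\pi\in\Pi(P,Q)}\Big(\iint_{\mathcal X\times\mathcal X}d_{\mathcal X}(x,y)^q\,\pi(dx,dy)\Big)^{1/q},$$ where $\Pi(P,Q)$ is the set of all $\pi\in\mathcal P(\mathcal X\times\mathcal X)$ with marginals $P$ and $Q$. The same notation is used on $\mathcal U$. $\mathcal S_*P=P\circ\mathcal S^{-1}$. *)

(* Defs.v *)
From HB Require Import structures.
From mathcomp Require Import all_boot all_order all_algebra.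
From mathcomp Require Import all_classical all_reals all_analysis.

Set Implicit Arguments.
Unset Strict Implicit.
Unset Printing Implicit Defensive.

Import Order.TTheory GRing.Theory Num.Theory.
Import numFieldNormedType.Exports.

Local Open Scope classical_set_scope.
Local Open Scope ring_scope.

(* Measurable types are pointed in MathComp-Analysis, so Borel spaces are built
   over pointed, i.e. nonempty, metric spaces; the point itself is never used. *)
#[short(type="pmetricType")]
HB.structure Definition PointedMetric (R : numDomainType) :=
  {T of Pointed T & Metric R T}.

Notation borel T := (g_sigma_algebraType (@open T)).

(* [borel (X * X)] is the Borel sigma-algebra of the product topology, which for
   nonseparable [X] may be larger than the product sigma-algebra. *)

Section wasserstein.
Context {R : realType} {X : pmetricType R}.
Implicit Types P Q : probability (borel X) R.

Definition finite_moment (q : R) : set (probability (borel X) R) :=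
  [set P : probability (borel X) R | exists x0 : X,
    (\int[P]_x (mdist (x : X) x0 `^ q)%:E < +oo)%E].

(* Probabilities are total functions on sets, meaningful on measurable sets
   only, hence the restriction on [A]. *)
Definition coupling P Q : set (probability (borel (X * X)%type) R) :=
  [set pi : probability (borel (X * X)%type) R |
     forall A : set (borel X), measurable A ->
     pi (fst @^-1` A) = P A /\ pi (snd @^-1` A) = Q A].

Definition wasserstein (q : R) P Q : \bar R :=
  ereal_inf [set ((\int[pi]_z (mdist (z.1 : X) (z.2 : X) `^ q)%:E) `^ q^-1)%E
            | pi in coupling P Q].

End wasserstein.

Section image_probability.
Context {R : realType} {d d' : measure_display}.
Context {T : measurableType d} {T' : measurableType d'}.

Definition image_probability (f : T -> T') (mf : measurable_fun [set: T] f)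
    (P : probability T R) : probability T' R :=
  distribution P (mfun_Sub (mem_set mf)).

Lemma image_probabilityE (f : T -> T') (mf : measurable_fun [set: T] f)
    (P : probability T R) (A : set T') :
  image_probability mf P A = P (f @^-1` A).
Proof. by []. Qed.

End image_probability.

(* [CS] stands for a function from [0, +oo) to [0, +oo); its values at negative
   reals are unconstrained. The library's [closed_ball] is the closure of an
   open ball, so the balls are spelled out. *)
Definition locally_hoelder {R : realType} {X U : pmetricType R} (S : X -> U)
    (beta : R) (x0 : X) (CS : R -> R) : Prop :=
  [/\ forall r, 0 <= r -> 0 <= CS r,
      forall r s, 0 <= r -> r <= s -> CS r <= CS s
    & forall r, 0 < r -> forall x1 x2 : X,
        mdist x1 x0 <= r -> mdist x2 x0 <= r ->
        mdist (S x1) (S x2) <= CS r * mdist x1 x2 `^ beta].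

(* Main.v *)
Require Import Defs.
From mathcomp Require Import all_boot all_order all_algebra.
From mathcomp Require Import all_classical all_reals all_analysis.
From mathcomp Require Import measurable_realfun ring lra.

Import Order.TTheory GRing.Theory Num.Theory.
Import numFieldNormedType.Exports.

Local Open Scope classical_set_scope.
Local Open Scope ring_scope.

(** Write [K x = CS (d (x, x0))] and [q = 2 * beta * p]. Since [CS] is
    nondecreasing, the Hoelder hypothesis on the ball whose radius is the larger
    of [d (x, x0)] and [d (y, x0)] reads
    [d (S x, S y) <= max (K x, K y) * d (x, y) ^ beta] ([hoelder_map_le]).

    Let [pi] be a coupling of [P] and [Q]. Raising this inequality to the power
    [p] and applying the Cauchy-Schwarz inequality under [pi]
    ([hoelder_majorant_integral]) bounds the [p]-th transport cost of the image
    of [pi] under [S * S], which couples the two pushforwards, by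
    [(int max (K x, K y) ^ (2 p))^(1/2) * (int d (x, y) ^ q)^(1/2)]. The first
    integral is at most [2 * C], because the maximum is below the sum and [pi]
    has marginals [P] and [Q] ([hoelder_coupling_cost]). Taking [p]-th roots and
    then the infimum over [pi] gives the estimate with the constant
    [(2 C) ^ (1 / (2 p))], which is at most [2 * C ^ (1 / (2 p))] because
    [2 p >= 1].

    The same computation with [y = x0] shows that the pushforwards have finite
    [p]-th moments.

    On a nonseparable space there may be no coupling on the Borel sigma-algebra
    of the product; the distance of [P] and [Q] is then infinite. This makes the
    estimate trivial when [C > 0], but not when [C = 0], as
    [0 * +oo = 0]. In that case [K] vanishes almost everywhere, so [S] is almost
    everywhere equal to [S x0] under [P] and [Q], both pushforwards are the
    Dirac mass at [S x0], and their distance vanishes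
    ([hoelder_image_wasserstein_null]). *)

(** * Borel measurability and continuity of the distance *)

Section measurability.
Context {R : realType}.

(** Stated for arbitrary generating families, so that it applies through
    [continuousP] both to [borel X] and to [borel (X * X)]. *)
Lemma generator_measurable (T T' : pointedType) (G : set (set T))
    (G' : set (set T')) (f : T -> T') :
  (forall B, G' B -> G (f @^-1` B)) ->
  measurable_fun [set: g_sigma_algebraType G]
    (f : g_sigma_algebraType G -> g_sigma_algebraType G').
Proof.
move=> fG.
refine (@measurability _ _ (g_sigma_algebraType G) (g_sigma_algebraType G')
  _ f G' erefl _) => _ [B GB <-].
by rewrite setTI; apply: sub_sigma_algebra; exact: fG.
Qed.

Lemma generator_measurable_real (T : pointedType) (G : set (set T)) (f : T -> R) :
  (forall B, open B -> G (f @^-1` B)) ->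
  measurable_fun [set: g_sigma_algebraType G] (f : g_sigma_algebraType G -> R).
Proof.
move=> fG; apply: (measurability _ (RGenOpens.measurableE R)).
move=> _ [_ [a [b ->]] <-]; rewrite setTI; apply: sub_sigma_algebra.
by apply: fG; exact: interval_open.
Qed.

Lemma mdist_continuous (X : pmetricType R) :
  continuous (fun z : X * X => mdist z.1 z.2 : R).
Proof.
move=> w; apply/cvgrPdist_lt => e e0.
have e2 : 0 < e / 2 by rewrite divr_gt0.
apply: filterS (nbhsx_ballx w _ e2) => z [] /=.
rewrite !ballEmdist /= => d1 d2.
have := metric_triangle w.1 z.1 w.2; have := metric_triangle z.1 z.2 w.2.
have := metric_triangle z.1 w.1 z.2; have := metric_triangle w.1 w.2 z.2.
rewrite (metric_sym z.1 w.1) (metric_sym z.2 w.2) => h1 h2 h3 h4.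
by rewrite ltr_norml; apply/andP; split; lra.
Qed.

Lemma mdistl_continuous (X : pmetricType R) (a : X) :
  continuous (fun x : X => mdist x a : R).
Proof.
move=> x; apply/cvgrPdist_lt => e e0.
apply: filterS (nbhsx_ballx x _ e0) => y; rewrite ballEmdist /= => xy.
have := metric_triangle x y a; have := metric_triangle y x a.
by rewrite (metric_sym y x) ltr_norml => h1 h2; apply/andP; split; lra.
Qed.

End measurability.

(** * Integral inequalities *)

Lemma lee_poweR (R : realType) (r : R) (x y : \bar R) :
  0 <= r -> (0 <= x)%E -> (x <= y)%E -> (x `^ r <= y `^ r)%E.
Proof.
move=> r0 x0 xy; apply: gt0_ler_poweR => //; rewrite in_itv /= leey andbT //.
exact: le_trans xy.
Qed.

(** The squares are real powers, to match the exponents [2 * p] below. *)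
Lemma cauchy_schwarz_integral {d} {T : measurableType d} {R : realType}
    (mu : {measure set T -> \bar R}) (f g : T -> R) :
    measurable_fun [set: T] f -> measurable_fun [set: T] g ->
    (forall x, 0 <= f x) -> (forall x, 0 <= g x) ->
  (\int[mu]_x (f x * g x)%:E <=
   (\int[mu]_x (f x `^ 2)%:E) `^ 2^-1 * (\int[mu]_x (g x `^ 2)%:E) `^ 2^-1)%E.
Proof.
move=> mf mg f0 g0.
have h2 : 2^-1 + 2^-1 = 1 :> R by field.
have := hoelder mu mf mg (@ltr0Sn _ 1) (@ltr0Sn _ 1) h2.
have sq h : (forall x, 0 <= h x) ->
    (\int[mu]_x `|(h x)%:E| `^ 2 = \int[mu]_x (h x `^ 2)%:E)%E.
  by move=> h0; apply: eq_integral => x _; rewrite gee0_abs ?lee_fin.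
rewrite Lnorm1 unlock /= !sq// => /(le_trans _); apply.
rewrite le_eqVlt; apply/orP; left; apply/eqP.
by apply: eq_integral => x _; rewrite ger0_norm ?mulr_ge0.
Qed.

(** Cauchy-Schwarz applied to [k ^ p] and [g ^ (beta p)], whose product
    majorizes [h ^ p]. *)
Lemma hoelder_majorant_integral {d} {T : measurableType d} {R : realType}
    (mu : {measure set T -> \bar R}) (beta p : R) (k g h : T -> R) :
    0 <= p ->
    measurable_fun [set: T] k -> measurable_fun [set: T] g ->
    measurable_fun [set: T] h ->
    (forall x, 0 <= k x) -> (forall x, 0 <= g x) -> (forall x, 0 <= h x) ->
    (forall x, h x <= k x * g x `^ beta) ->
  (\int[mu]_x (h x `^ p)%:E <=
   (\int[mu]_x (k x `^ (2 * p))%:E) `^ 2^-1 *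
   (\int[mu]_x (g x `^ (2 * beta * p))%:E) `^ 2^-1)%E.
Proof.
move=> p0 mk mg mh k0 g0 h0 hkg.
have mpow (f : T -> R) r : measurable_fun [set: T] f ->
    measurable_fun [set: T] (fun x => f x `^ r).
  by move=> mf; exact: (measurableT_comp (measurable_powR r) mf).
have -> : (\int[mu]_x (k x `^ (2 * p))%:E =
           \int[mu]_x ((k x `^ p) `^ 2)%:E)%E.
  by apply: eq_integral => x _; rewrite mulrC powRrM.
have -> : (\int[mu]_x (g x `^ (2 * beta * p))%:E =
           \int[mu]_x ((g x `^ (beta * p)) `^ 2)%:E)%E.
  by apply: eq_integral => x _; rewrite -mulrA (mulrC 2) (powRrM _ _ 2).
apply: le_trans; last first.
  by apply: cauchy_schwarz_integral;
    [exact: mpow|exact: mpow|move=> x; exact: powR_ge0..].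
apply: ge0_le_integral => //.
- by move=> x _; rewrite lee_fin powR_ge0.
- exact/measurable_EFinP/mpow.
- by apply/measurable_EFinP/measurable_funM; exact: mpow.
- move=> x _; rewrite lee_fin [X in _ * X]powRrM -powRM ?powR_ge0//.
  by apply: ge0_ler_powR; rewrite ?nnegrE ?mulr_ge0 ?powR_ge0.
Qed.

(** For [c > 0] the map [t |-> c * t ^ beta] is an increasing bijection of the
    extended half-line onto itself, so the bound can be moved to [t], where the
    infimum is taken, and back. For [c = 0], [E] empty and [w > 0] the
    conclusion would fail. *)
Lemma le_mule_poweR_ereal_inf {R : realType} (c beta : R) (w : \bar R)
    (E : set (\bar R)) :
    0 < c -> 0 < beta -> (0 <= w)%E -> (forall t, E t -> (0 <= t)%E) ->
    (forall t, E t -> (w <= c%:E * t `^ beta)%E) ->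
  (w <= c%:E * ereal_inf E `^ beta)%E.
Proof.
move=> c0 beta0 w0 E0 wE.
have c1w (x : \bar R) : (c%:E * (c^-1%:E * x) = x)%E.
  by rewrite muleA -EFinM divff ?gt_eqF// mul1e.
have m0 : (0 <= c^-1%:E * w)%E by rewrite mule_ge0// lee_fin invr_ge0 ltW.
have mE : ((c^-1%:E * w) `^ beta^-1 <= ereal_inf E)%E.
  apply/ereal_infP => t Et.
  have -> : t = ((t `^ beta) `^ beta^-1)%E.
    by rewrite -poweRrM divff ?gt_eqF// poweRe1// E0.
  apply: lee_poweR => //; first by rewrite invr_ge0 ltW.
  rewrite -(@lee_pmul2l _ c%:E) ?lte_fin// c1w; exact: wE.
rewrite -[leLHS]c1w; apply: lee_wpmul2l; first by rewrite lee_fin ltW.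
rewrite -[leLHS]poweRe1// -(@mulVf _ beta) ?gt_eqF// poweRrM.
by apply: lee_poweR => //; [exact: ltW|exact: poweR_ge0].
Qed.

(** * Images of probabilities, moments and couplings *)

Lemma ae_cst_preimage {d d'} {T : measurableType d} {T' : measurableType d'}
    {R : realType} (P : probability T R) (f : T -> T') (c : T') :
    measurable_fun [set: T] f -> {ae P, forall x, f x = c} ->
  forall A, measurable A -> P (f @^-1` A) = \d_c A.
Proof.
move=> mf fc A mA.
have mfA : measurable (f @^-1` A) by rewrite -[X in measurable X]setTI; exact: mf.
rewrite -(setIT (f @^-1` A)) -integral_indic//.
rewrite (ae_eq_integral (cst (\d_c A : \bar R)))//=.
- by rewrite integral_cst//= probability_setT mule1.
- exact/measurable_EFinP.
- apply: filterS fc => x /= fxc _.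
  by rewrite indicE diracE -fxc; congr (_ %:R)%:E; apply/idP/idP; rewrite !inE.
Qed.

Lemma integral_image_probability {R : realType} {d d'} {T : measurableType d}
    {T' : measurableType d'} (f : T -> T') (mf : measurable_fun [set: T] f)
    (P : probability T R) (g : T' -> \bar R) :
  measurable_fun [set: T'] g -> (forall y, (0 <= g y)%E) ->
  (\int[image_probability mf P]_y g y = \int[P]_x g (f x))%E.
Proof. by move=> mg g0; rewrite ge0_integral_distribution. Qed.

Section couplings.
Context {R : realType} {X : pmetricType R}.
Implicit Types P Q : probability (borel X) R.

Lemma measurable_fst_borel :
  measurable_fun [set: borel (X * X)%type] (fst : borel (X * X)%type -> borel X).
Proof. by apply: generator_measurable; apply/continuousP => x; exact: cvg_fst. Qed.

Lemma measurable_snd_borel :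
  measurable_fun [set: borel (X * X)%type] (snd : borel (X * X)%type -> borel X).
Proof. by apply: generator_measurable; apply/continuousP => x; exact: cvg_snd. Qed.

Lemma measurable_mdist_borel :
  measurable_fun [set: borel (X * X)%type]
    (fun z : borel (X * X)%type => mdist (z.1 : X) (z.2 : X)).
Proof. by apply: generator_measurable_real; apply/continuousP/mdist_continuous. Qed.

Lemma measurable_mdistl_borel (a : X) :
  measurable_fun [set: borel X] (fun x : borel X => mdist (x : X) a).
Proof. by apply: generator_measurable_real; apply/continuousP/mdistl_continuous. Qed.

(** A coupling prescribes its marginals on measurable sets only, which is enough
    to determine integrals. *)
Lemma coupling_integral_fst P Q pi (f : borel X -> \bar R) :
    coupling P Q pi -> measurable_fun [set: borel X] f ->
    (forall x, (0 <= f x)%E) ->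
  (\int[pi]_z f z.1 = \int[P]_x f x)%E.
Proof.
move=> piPQ mf f0.
rewrite -(integral_image_probability _ measurable_fst_borel pi f)//.
apply: eq_measure_integral => A mA _.
exact: (piPQ A mA).1.
Qed.

Lemma coupling_integral_snd P Q pi (f : borel X -> \bar R) :
    coupling P Q pi -> measurable_fun [set: borel X] f ->
    (forall x, (0 <= f x)%E) ->
  (\int[pi]_z f z.2 = \int[Q]_x f x)%E.
Proof.
move=> piPQ mf f0.
rewrite -(integral_image_probability _ measurable_snd_borel pi f)//.
apply: eq_measure_integral => A mA _.
exact: (piPQ A mA).2.
Qed.

(** The moment condition does not depend on the base point, since
    [d (x, a) <= 2 * max (d (x, b), d (b, a))]. *)
Lemma finite_moment_base q P (a : X) : 0 <= q -> finite_moment q P ->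
  (\int[P]_x (mdist (x : X) a `^ q)%:E < +oo)%E.
Proof.
move=> q0 [b Pb].
have mb : measurable_fun [set: borel X] (fun x => (mdist (x : X) b `^ q)%:E).
  apply/measurable_EFinP.
  exact: (measurableT_comp (measurable_powR q) (measurable_mdistl_borel b)).
have ma : measurable_fun [set: borel X] (fun x => (mdist (x : X) a `^ q)%:E).
  apply/measurable_EFinP.
  exact: (measurableT_comp (measurable_powR q) (measurable_mdistl_borel a)).
have pw (x : X) : mdist x a `^ q <=
    2 `^ q * mdist x b `^ q + 2 `^ q * mdist b a `^ q.
  have h r : 0 <= r -> mdist x a <= 2 * r -> mdist x a `^ q <= 2 `^ q * r `^ q.
    move=> r0 xr; rewrite -powRM//.
    by apply: ge0_ler_powR; rewrite ?nnegrE ?mdist_ge0 ?mulr_ge0.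
  have tr := metric_triangle x b a.
  have [ba|/ltW xb] := leP (mdist b a) (mdist x b).
    rewrite (le_trans (h (mdist x b) (mdist_ge0 _ _) _))//; first lra.
    by rewrite lerDl mulr_ge0 ?powR_ge0.
  rewrite (le_trans (h (mdist b a) (mdist_ge0 _ _) _))//; first lra.
  by rewrite lerDr mulr_ge0 ?powR_ge0.
apply: (@le_lt_trans _ _ (\int[P]_x ((2 `^ q)%:E * (mdist (x : X) b `^ q)%:E +
    (2 `^ q * mdist b a `^ q)%:E))%E).
  apply: ge0_le_integral => //.
  - by move=> x _; rewrite lee_fin powR_ge0.
  - by apply: emeasurable_funD => //; exact: measurable_funeM.
  - by move=> x _; rewrite -EFinM -EFinD lee_fin.
rewrite ge0_integralD//=; first last.
- by move=> x _; rewrite lee_fin mulr_ge0 ?powR_ge0.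
- exact: measurable_funeM.
- by move=> x _; rewrite -EFinM lee_fin mulr_ge0 ?powR_ge0.
rewrite ge0_integralZl ?lee_fin ?powR_ge0//; last first.
  by move=> x _; rewrite lee_fin powR_ge0.
rewrite integral_cst//= probability_setT mule1.
apply: lte_add_pinfty; rewrite ?ltry//.
by rewrite lte_mul_pinfty// lee_fin powR_ge0.
Qed.

Lemma wasserstein_coupling_le q P Q pi : coupling P Q pi ->
  (wasserstein q P Q <=
   (\int[pi]_z (mdist (z.1 : X) (z.2 : X) `^ q)%:E) `^ q^-1)%E.
Proof. by move=> piPQ; apply: ereal_inf_lbound; exists pi. Qed.

Lemma wasserstein_ge0 q P Q : (0 <= wasserstein q P Q)%E.
Proof. by apply/ereal_infP => _ [pi _ <-]; exact: poweR_ge0. Qed.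

End couplings.

Section image_coupling.
Context {R : realType} {X U : pmetricType R} (S : X -> U).
Hypothesis S_continuous : continuous S.

Lemma measurable_borel_pair :
  measurable_fun [set: borel (X * X)%type]
    ((fun z => (S z.1, S z.2)) : borel (X * X)%type -> borel (U * U)%type).
Proof.
apply: generator_measurable; apply/continuousP => z.
apply: cvg_pair => /=.
  by apply: cvg_comp; [exact: cvg_fst|exact: S_continuous].
by apply: cvg_comp; [exact: cvg_snd|exact: S_continuous].
Qed.

Lemma coupling_image (mS : measurable_fun [set: borel X] (S : borel X -> borel U))
    P Q pi : coupling P Q pi ->
  coupling (image_probability mS P) (image_probability mS Q)
    (image_probability measurable_borel_pair pi).
Proof.
move=> piPQ A mA.
have mSA : measurable ((S : borel X -> borel U) @^-1` A).
  by rewrite -[X in measurable X]setTI; exact: mS.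
by have [? ?] := piPQ _ mSA.
Qed.

End image_coupling.

(** * Locally Hoelder maps *)

Section hoelder_map.
Context {R : realType} {X U : pmetricType R} (S : X -> U).
Context (beta : R) (x0 : X) (CS : R -> R).
Hypothesis S_hoelder : locally_hoelder S beta x0 CS.

Let K (x : X) := CS (mdist x x0).

Lemma hoelder_modulus_ge0 x : 0 <= CS (mdist (x : X) x0).
Proof. by case: S_hoelder => CS0 _ _; exact/CS0/mdist_ge0. Qed.

(** The modulus is a monotone function of a continuous one. As nothing is known
    of [CS] on negative reals, [CS] is first composed with [max 0]. *)
Lemma hoelder_modulus_measurable :
  measurable_fun [set: borel X] (K : borel X -> R).
Proof.
case: S_hoelder => _ CSnd _.
have -> : K = (CS \o Num.max 0) \o (fun x => mdist x x0).
  by apply/funext => x; rewrite /K /= max_r ?mdist_ge0.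
apply: measurableT_comp; last first.
  by apply: generator_measurable_real; apply/continuousP/mdistl_continuous.
apply: nondecreasing_measurable => // r s rs; apply: CSnd.
  by rewrite le_max lexx.
by rewrite ge_max !le_max lexx rs !orbT.
Qed.

(** The Hoelder condition used on the smallest ball containing both points. That
    ball is degenerate when [x = y = x0], where both sides are compared
    directly. *)
Lemma hoelder_map_le x y :
  mdist (S x) (S y) <= Num.max (K x) (K y) * mdist x y `^ beta.
Proof.
case: S_hoelder => CS0 CSnd CSh.
wlog yx : x y / mdist y x0 <= mdist x x0.
  move=> h; have [|/ltW yx] := leP (mdist y x0) (mdist x x0); first exact: h.
  by rewrite metric_sym (metric_sym x) maxC; exact: h.
apply: (@le_trans _ _ (K x * mdist x y `^ beta)); last first.
  by rewrite ler_wpM2r ?powR_ge0// le_max lexx.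
have := mdist_ge0 x x0; rewrite le_eqVlt => /predU1P[d0|d0]; last exact: CSh.
have -> : y = x.
  rewrite (mdist_positivity _ _ (esym d0)); apply: mdist_positivity.
  by apply/eqP; rewrite eq_le mdist_ge0 andbT d0.
by rewrite mdistxx mulr_ge0 ?powR_ge0// hoelder_modulus_ge0.
Qed.

Lemma hoelder_map_base_le x :
  mdist (S x) (S x0) <= K x * mdist x x0 `^ beta.
Proof.
case: S_hoelder => CS0 CSnd _.
rewrite (le_trans (hoelder_map_le x x0))// ler_wpM2r ?powR_ge0// ge_max lexx /=.
by rewrite CSnd ?mdistxx ?mdist_ge0.
Qed.

Lemma hoelder_map_continuous : 0 < beta -> continuous S.
Proof.
move=> beta0 x; case: S_hoelder => CS0 CSnd CSh.
apply/metricType_numDomainType.cvgrPdist_le => e e0.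
set r := mdist x x0 + 1.
have r0 : 0 < r by rewrite ltr_wpDl ?mdist_ge0.
have c0 : 0 < CS r + 1 by rewrite ltr_wpDl ?CS0 ?ltW.
have ec0 : 0 < e / (CS r + 1) by rewrite divr_gt0.
(* The bound 1 keeps [y] in the ball of radius [r]; the other one solves
   [(CS r + 1) * t `^ beta = e], where [+ 1] avoids a division by zero. *)
have d0 : 0 < Num.min 1 ((e / (CS r + 1)) `^ beta^-1).
  by rewrite lt_min ltr01 powR_gt0.
apply: filterS (nbhsx_ballx x _ d0) => y; rewrite ballEmdist /= lt_min.
move=> /andP[xy1 xyd].
have yr : mdist y x0 <= r.
  rewrite (le_trans (metric_triangle y x x0))// addrC lerD2l metric_sym.
  exact: ltW.
have xr : mdist x x0 <= r by rewrite lerDl.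
rewrite (le_trans (CSh _ r0 _ _ xr yr))//.
have : mdist x y `^ beta <= e / (CS r + 1).
  rewrite (le_trans (ge0_ler_powR (ltW beta0) _ _ (ltW xyd)))//.
  - by rewrite nnegrE mdist_ge0.
  - by rewrite nnegrE powR_ge0.
  - by rewrite -powRrM mulVf ?gt_eqF// powRr1// ltW.
rewrite ler_pdivlMr// => h.
by rewrite (le_trans _ h)// mulrC ler_wpM2l ?powR_ge0// lerDl.
Qed.

End hoelder_map.

(** * Pushforward under a locally Hoelder map *)

Section hoelder_image.
Context {R : realType} {X U : pmetricType R} (S : X -> U).
Context (beta : R) (x0 : X) (CS : R -> R) (p : R).
Hypothesis beta_gt0 : 0 < beta.
Hypothesis S_hoelder : locally_hoelder S beta x0 CS.
Hypothesis p_gt0 : 0 < p.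
Implicit Types P Q : probability (borel X) R.

Let K (x : borel X) := CS (mdist (x : X) x0).

Let p_ge0 : 0 <= p. Proof. exact: ltW. Qed.

Let K_ge0 x : 0 <= K x. Proof. exact: hoelder_modulus_ge0 S_hoelder x. Qed.

Let measurable_K : measurable_fun [set: borel X] K.
Proof. exact: hoelder_modulus_measurable S_hoelder. Qed.

Let measurable_K2p :
  measurable_fun [set: borel X] (fun x => (K x `^ (2 * p))%:E).
Proof.
by apply/measurable_EFinP; exact: (measurableT_comp (measurable_powR _)).
Qed.

Let S_continuous : continuous S.
Proof. exact: hoelder_map_continuous S_hoelder beta_gt0. Qed.

Lemma hoelder_map_measurable :
  measurable_fun [set: borel X] (S : borel X -> borel U).
Proof. by apply: generator_measurable; apply/continuousP. Qed.

(** The case [y = x0] of the transport estimate: it controls the moments of the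
    pushforward, and vanishes with the integral of the modulus. *)
Lemma hoelder_base_cost P :
  (\int[P]_x (mdist (S x) (S x0) `^ p)%:E <=
   (\int[P]_x (K x `^ (2 * p))%:E) `^ 2^-1 *
   (\int[P]_x (mdist (x : X) x0 `^ (2 * beta * p))%:E) `^ 2^-1)%E.
Proof.
apply: (@hoelder_majorant_integral _ _ _ P beta p K
  (fun x => mdist (x : X) x0) (fun x => mdist (S x) (S x0))) => //.
- exact: measurable_mdistl_borel.
- exact: (measurableT_comp (measurable_mdistl_borel (S x0)) hoelder_map_measurable).
- by move=> x; exact: mdist_ge0.
- by move=> x; exact: mdist_ge0.
- exact: hoelder_map_base_le.
Qed.

Lemma hoelder_image_finite_moment P (C : R)
    (mS : measurable_fun [set: borel X] (S : borel X -> borel U)) :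
    finite_moment (2 * beta * p) P ->
    (\int[P]_x (K x `^ (2 * p))%:E <= C%:E)%E ->
  finite_moment p (image_probability mS P).
Proof.
move=> P_moment PC; exists (S x0).
rewrite integral_image_probability; last 2 first.
- apply/measurable_EFinP.
  exact: (measurableT_comp (measurable_powR p) (measurable_mdistl_borel (S x0))).
- by move=> y; rewrite lee_fin powR_ge0.
have PK := le_lt_trans PC (ltry C).
have q0 : 0 <= 2 * beta * p by rewrite !mulr_ge0// ltW.
have Pd := finite_moment_base _ _ x0 q0 P_moment.
apply: (le_lt_trans (hoelder_base_cost P)).
apply: lte_mul_pinfty; rewrite ?poweR_ge0 ?poweR_lty//.
by rewrite ge0_fin_numE ?poweR_ge0 ?poweR_lty.
Qed.

(** Cauchy-Schwarz separates the modulus from the distance; the modulus is then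
    integrated through the marginals, on which alone its bounds are known. *)
Lemma hoelder_coupling_cost P Q pi (C : R) :
    coupling P Q pi ->
    (\int[P]_x (K x `^ (2 * p))%:E <= C%:E)%E ->
    (\int[Q]_x (K x `^ (2 * p))%:E <= C%:E)%E ->
  ((\int[pi]_z (mdist (S z.1) (S z.2) `^ p)%:E) `^ p^-1 <=
   ((2 * C) `^ (2 * p)^-1)%:E *
   ((\int[pi]_z (mdist (z.1 : X) (z.2 : X) `^ (2 * beta * p))%:E)
     `^ (2 * beta * p)^-1) `^ beta)%E.
Proof.
move=> piPQ PC QC.
have m1 : measurable_fun [set: borel (X * X)%type] (fun z => K z.1).
  exact: (measurableT_comp measurable_K measurable_fst_borel).
have m2 : measurable_fun [set: borel (X * X)%type] (fun z => K z.2).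
  exact: (measurableT_comp measurable_K measurable_snd_borel).
pose M (z : borel (X * X)%type) := Num.max (K z.1) (K z.2).
have mM : measurable_fun setT M by exact: measurable_maxr.
have M0 z : 0 <= M z by rewrite le_max K_ge0.
have pow0 (r s : R) : (0 <= (r `^ s)%:E)%E by rewrite lee_fin powR_ge0.
have M_le : (\int[pi]_z (M z `^ (2 * p))%:E <= (2 * C)%:E)%E.
  apply: (@le_trans _ _
    (\int[pi]_z ((K z.1 `^ (2 * p))%:E + (K z.2 `^ (2 * p))%:E))%E).
    apply: ge0_le_integral => //.
    - by apply/measurable_EFinP; exact: (measurableT_comp (measurable_powR _)).
    - by apply: emeasurable_funD; apply/measurable_EFinP;
        exact: (measurableT_comp (measurable_powR _)).
    - move=> z _; rewrite -EFinD lee_fin /M.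
      by case: (leP (K z.1) (K z.2)) => _; rewrite ?lerDl ?lerDr powR_ge0.
  rewrite ge0_integralD//; first last.
  - by apply/measurable_EFinP; exact: (measurableT_comp (measurable_powR _)).
  - by apply/measurable_EFinP; exact: (measurableT_comp (measurable_powR _)).
  rewrite (coupling_integral_fst P Q pi (fun x => (K x `^ (2 * p))%:E))//.
  rewrite (coupling_integral_snd P Q pi (fun x => (K x `^ (2 * p))%:E))//.
  by rewrite (mulr_natl C 2) (mulr2n C) EFinD leeD.
set I := (\int[pi]_z (mdist (z.1 : X) (z.2 : X) `^ (2 * beta * p))%:E)%E.
have I0 : (0 <= I)%E by exact: integral_ge0.
have cost : (\int[pi]_z (mdist (S z.1) (S z.2) `^ p)%:E <=
    (2 * C)%:E `^ 2^-1 * I `^ 2^-1)%E.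
  have := @hoelder_majorant_integral _ _ _ pi beta p M
    (fun z => mdist (z.1 : X) (z.2 : X)) (fun z => mdist (S z.1) (S z.2)).
  move=> /(_ p_ge0 mM measurable_mdist_borel
    (measurableT_comp measurable_mdist_borel (measurable_borel_pair S S_continuous))
    M0 (fun=> mdist_ge0 _ _) (fun=> mdist_ge0 _ _)).
  move=> /(_ (fun z => hoelder_map_le S beta x0 CS S_hoelder z.1 z.2)) /le_trans.
  apply; apply: lee_wpmul2r; first exact: poweR_ge0.
  by apply: lee_poweR => //; exact: integral_ge0.
have C0 : (0 <= (2 * C)%:E)%E by apply: le_trans M_le; exact: integral_ge0.
apply: le_trans (lee_poweR _ _ _ _ _ _ cost) _; first by rewrite invr_ge0.
  exact: integral_ge0.
rewrite poweRM ?poweR_ge0// -!poweRrM -invfM poweR_EFin.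
suff -> : (2 * beta * p)^-1 * beta = (2 * p)^-1 by [].
by field; rewrite !gt_eqF.
Qed.

Lemma hoelder_image_wasserstein_le P Q (C : R)
    (mS : measurable_fun [set: borel X] (S : borel X -> borel U)) :
    0 < C ->
    (\int[P]_x (K x `^ (2 * p))%:E <= C%:E)%E ->
    (\int[Q]_x (K x `^ (2 * p))%:E <= C%:E)%E ->
  (wasserstein p (image_probability mS P) (image_probability mS Q) <=
   ((2 * C) `^ (2 * p)^-1)%:E * wasserstein (2 * beta * p) P Q `^ beta)%E.
Proof.
move=> C0 PC QC; apply: le_mule_poweR_ereal_inf => //.
- by rewrite powR_gt0// mulr_gt0.
- exact: wasserstein_ge0.
- by move=> _ [pi _ <-]; exact: poweR_ge0.
move=> _ [pi piPQ <-].
apply: le_trans (hoelder_coupling_cost P Q pi C piPQ PC QC).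
apply: le_trans (wasserstein_coupling_le _ _ _ _
  (coupling_image S S_continuous mS P Q pi piPQ)) _.
rewrite (integral_image_probability _ (measurable_borel_pair S S_continuous) pi
  (fun z => (mdist (z.1 : U) (z.2 : U) `^ p)%:E))//.
  apply/measurable_EFinP.
  exact: (measurableT_comp (measurable_powR p) measurable_mdist_borel).
by move=> z; rewrite lee_fin powR_ge0.
Qed.

(** Where the modulus at [x] vanishes, the Hoelder condition compares [S x] to
    [S x0] with constant zero. *)
Lemma hoelder_map_ae_cst P :
    (\int[P]_x (K x `^ (2 * p))%:E <= 0)%E ->
  {ae P, forall x, (S x : U) = S x0}.
Proof.
move=> PK.
have : (\int[P]_x `|(K x `^ (2 * p))%:E| = 0)%E.
  apply/eqP; rewrite eq_le integral_ge0// andbT.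
  by under eq_integral do rewrite gee0_abs ?lee_fin ?powR_ge0//.
move=> /(ae_eq_integral_abs _ measurableT) => /(_ measurable_K2p).
apply: filterS => x /(_ I) [/powR_eq0_eq0 Kx].
apply: mdist_positivity; apply/eqP; rewrite eq_le mdist_ge0 andbT.
rewrite (le_trans (hoelder_map_base_le _ _ _ _ S_hoelder x))//.
by rewrite -/(K x) Kx mul0r.
Qed.

(** The second pushforward is the Dirac mass at [S x0], so the image of [P]
    under [x |-> (S x, S x0)] is a coupling, whose cost is bounded by
    [hoelder_base_cost]; this does not presuppose a coupling of [P] and [Q]. *)
Lemma hoelder_image_wasserstein_null P Q
    (mS : measurable_fun [set: borel X] (S : borel X -> borel U)) :
    (\int[P]_x (K x `^ (2 * p))%:E <= 0)%E ->
    (\int[Q]_x (K x `^ (2 * p))%:E <= 0)%E ->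
  (wasserstein p (image_probability mS P) (image_probability mS Q) <= 0)%E.
Proof.
move=> PK QK.
have mg : measurable_fun [set: borel X]
    ((fun x => (S x, S x0)) : borel X -> borel (U * U)%type).
  apply: generator_measurable; apply/continuousP => x.
  by apply: cvg_pair => /=; [exact: S_continuous|exact: cvg_cst].
have PQ : coupling (image_probability mS P) (image_probability mS Q)
    (image_probability mg P).
  move=> A mA; split => //.
  rewrite [RHS](ae_cst_preimage Q _ (S x0 : borel U) mS _ A mA);
    last exact: hoelder_map_ae_cst.
  apply: (ae_cst_preimage P (cst (S x0 : borel U)) (S x0 : borel U)) => //.
  exact: aeW.
apply: le_trans (wasserstein_coupling_le _ _ _ _ PQ) _.
rewrite (integral_image_probability _ mg P
  (fun z => (mdist (z.1 : U) (z.2 : U) `^ p)%:E)).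
- have -> : (\int[P]_x (mdist (S x) (S x0) `^ p)%:E = 0)%E.
    apply/eqP; rewrite eq_le; apply/andP; split; last first.
      by apply: integral_ge0 => x _; rewrite lee_fin powR_ge0.
    apply: le_trans (hoelder_base_cost P) _.
    have -> : (\int[P]_x (K x `^ (2 * p))%:E = 0)%E.
      apply/eqP; rewrite eq_le PK integral_ge0// => x _.
      by rewrite lee_fin powR_ge0.
    by rewrite poweR0r ?mul0e// invr_eq0.
  by rewrite poweR0r// invr_eq0 gt_eqF.
- apply/measurable_EFinP.
  exact: (measurableT_comp (measurable_powR p) measurable_mdist_borel).
- by move=> z; rewrite lee_fin powR_ge0.
Qed.

End hoelder_image.

Theorem theorem3p5 (R : realType) (X U : pmetricType R) (S : X -> U)
    (beta : R) (x0 : X) (CS : R -> R)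
    (beta_gt0 : 0 < beta) (beta_le1 : beta <= 1)
    (S_hoelder : locally_hoelder S beta x0 CS)
    (p : R) (p_ge1 : 1 <= p)
    (P Q : probability (borel X) R)
    (P_moment : finite_moment (2 * beta * p) P)
    (Q_moment : finite_moment (2 * beta * p) Q)
    (C : R)
    (P_bound :
      (\int[P]_x (CS (mdist (x : X) x0) `^ (2 * p))%:E <= C%:E)%E)
    (Q_bound :
      (\int[Q]_x (CS (mdist (x : X) x0) `^ (2 * p))%:E <= C%:E)%E) :
  exists mS : measurable_fun [set: borel X] (S : borel X -> borel U),
    [/\ finite_moment p (image_probability mS P),
        finite_moment p (image_probability mS Q)
      & (wasserstein p (image_probability mS P) (image_probability mS Q)
         <= (2 * C `^ (2 * p)^-1)%:E
            * wasserstein (2 * beta * p) P Q `^ beta)%E].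
Proof.
have p_gt0 : 0 < p by exact: lt_le_trans ltr01 p_ge1.
have mS := hoelder_map_measurable S beta x0 CS beta_gt0 S_hoelder.
exists mS; split.
- exact: (hoelder_image_finite_moment _ _ _ _ _ beta_gt0 S_hoelder p_gt0 _ C).
- exact: (hoelder_image_finite_moment _ _ _ _ _ beta_gt0 S_hoelder p_gt0 _ C).
have : (0 <= C%:E)%E.
  by apply: le_trans P_bound; apply: integral_ge0 => x _; rewrite lee_fin powR_ge0.
rewrite lee_fin le_eqVlt => /predU1P[C0|C0].
  (* The right-hand side is zero here, even if [P] and [Q] have no coupling. *)
  rewrite -C0 in P_bound Q_bound *.
  rewrite powR0 ?mulr0 ?mul0e;
    first exact: (hoelder_image_wasserstein_null _ beta x0 CS).
  by rewrite invr_eq0 mulf_neq0 ?gt_eqF.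
apply: le_trans (hoelder_image_wasserstein_le _ _ _ _ _ beta_gt0 S_hoelder
  p_gt0 _ _ _ mS C0 P_bound Q_bound) _.
apply: lee_wpmul2r; first exact: poweR_ge0.
rewrite lee_fin powRM ?(ltW C0)// ler_wpM2r ?powR_ge0// ler1_powR ?ler1n//.
by rewrite invf_le1 ?mulr_gt0//; lra.
Qed.
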